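(* Let $\mathcal{F}$ be a commutative perfect Banach semi-field of characteristic $1$ with fixed element $E$, let $\sim$ be a closed congruence on $\mathcal{F}$, $\pi:\mathcal{F}\to\mathcal{F}/\sim$ the projection, $E_1=\pi(E)$, $K_1=S_{E_1}(\mathcal{F}/\sim)$, and $j:K_1\to S_E(\mathcal{F})$ the map $j(\phi)=\phi\circ\pi$. For $X\in\mathcal{F}$ let $\Theta_X\in C^0(S_E(\mathcal{F}),\mathbb{R})$ be $\Theta_X(\phi)=\phi(X)$. Then: 1. For all $X,Y\in\mathcal{F}$: $X\sim Y$ if and only if $(\Theta_X)_{|j(K_1)}=(\Theta_Y)_{|j(K_1)}$. 2. The map $$\Theta^1:(\mathcal{F}/\sim,\oplus,+)\to(C^0(K_1,\mathbb{R}),\max(\,,),+),\qquad X_1\mapsto\Theta^1_{X_1},\quad\Theta^1_{X_1}(\phi)=\phi(X_1),$$ is an isometric isomorphism of Banach semi-fields: $$\forall X_1\in\mathcal{F}/\sim,\quad \inf_{X\in\mathcal{F},\,\pi(X)=X_1}r(X)=\max_{\phi\in K_1}|\Theta^1_{X_1}(\phi)|=r_\sim(X_1).$$ 3. For all $X\in\mathcal{F}$ and $\phi\in K_1$, $\Theta^1_{\pi(X)}(\phi)=\Theta_X(\phi\circ\pi)$. (That is, under the identification of $K_1$ with $j(K_1)$, $\Theta^1_{\pi(X)}$ is the restriction of $\Theta_X$ to $j(K_1)$.)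
   Context: A commutative perfect semi-field of characteristic $1$ is a triple $(\mathcal{F},\oplus,+)$ where: $\oplus$ is a commutative associative law with $X\oplus X=X$ for all $X$; $(\mathcal{F},+)$ is an abelian group with identity $0$ and $X+(Y\oplus Z)=(X+Y)\oplus(X+Z)$ for all $X,Y,Z$; for every integer $n\ge 1$ the map $X\mapsto nX$ is surjective (it is then bijective, and $(\mathcal F,+)$ is naturally a $\mathbb{Q}$-vector space). Partial order: $X\le Y$ iff $X\oplus Y=Y$. Standing assumptions: $\mathcal{F}\neq\{0\}$; there is a fixed $E\in\mathcal{F}$ such that for every $X\in\mathcal{F}$ there is $t\in\mathbb{Q}^+$ with $-tE\le X\le tE$; $r(X)\in\mathbb{R}^+$ denotes the infimum of all such $t$; and $r(X)=0$ if and only if $X=0$. $\mathcal{F}$ is Banach if it is complete for the distance $r(X-Y)$. A character of $\mathcal{F}$ is a map $\phi:\mathcal{F}\to\mathbb{R}$, not identically zero, with $\phi(X\oplus Y)=\max(\phi(X),\phi(Y))$ and $\phi(X+Y)=\phi(X)+\phi(Y)$. $S_E(\mathcal{F})$ is the set of characters with $\phi(E)=1$, with the weakest topology making all maps $\phi\mapsto\phi(X)$ continuous. A congruence on $\mathcal{F}$ is an equivalence relation $\sim$ such that $X\sim Y$ implies $-X\sim -Y$, $X+Z\sim Y+Z$ and $X\oplus Z\sim Y\oplus Z$ for all $Z$; it is closed if it is a closed subset of $\mathcal{F}\times\mathcal{F}$ (for the distance $r(X-Y)$). The quotient $\mathcal{F}/\sim$ with the induced laws is again a commutative perfect semi-field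 of characteristic $1$, and satisfies the same assumptions with $E_1=\pi(E)$ in place of $E$: $r_\sim(X_1)$ denotes the infimum of the $t\in\mathbb{Q}^+$ with $-tE_1\le X_1\le tE_1$, and $r_\sim(X_1)=0$ iff $X_1=0$. $S_{E_1}(\mathcal{F}/\sim)$ is the set of characters $\phi$ of $\mathcal{F}/\sim$ with $\phi(E_1)=1$, with the weakest topology making all maps $\phi\mapsto\phi(X_1)$ continuous; $j$ is a homeomorphism onto its (compact) image. If $K_1$ is empty, the maximum over $K_1$ is read as $0$. *)

(* Defs.v *)
From HB Require Import structures.
From mathcomp Require Import all_boot all_order all_algebra.
From mathcomp Require Import all_classical all_reals all_analysis.

Set Implicit Arguments.
Unset Strict Implicit.
Unset Printing Implicit Defensive.

Import Order.TTheory GRing.Theory Num.Theory.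
Import numFieldNormedType.Exports.

Local Open Scope classical_set_scope.
Local Open Scope ring_scope.
Local Open Scope quotient_scope.

Declare Scope semifield_scope.
Delimit Scope semifield_scope with SF.
Local Open Scope semifield_scope.

(* In a semi-field of characteristic 1 the group law, written [+], plays the
   role of the multiplication and the idempotent law [oplus] that of the
   addition.  There is no absorbing element. *)
HB.mixin Record isPerfectSemifield F of GRing.Zmodule F := {
  oplus : F -> F -> F ;
  oplusA : associative oplus ;
  oplusC : commutative oplus ;
  oplusxx : idempotent_op oplus ;
  addr_oplusr : right_distributive (+%R : F -> F -> F) oplus ;
  mulrn_surj : forall n : nat, (0 < n)%N ->
    forall Y : F, exists X : F, X *+ n = Y
}.

#[short(type="perfectSemifieldType")]
HB.structure Definition PerfectSemifield :=
  {F of GRing.Zmodule F & isPerfectSemifield F}.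

Notation "X ⊕ Y" := (oplus X Y) (at level 50, left associativity)
  : semifield_scope.

Definition sle (F : perfectSemifieldType) (X Y : F) : Prop := X ⊕ Y = Y.

Notation "X ⊑ Y" := (sle X Y) (at level 70, no associativity)
  : semifield_scope.

(* The action of [rat] on the group: [qscale t X] is the only [Y] such that
   [denq t] times [Y] is [numq t] times [X] (see [qscale_unique]). *)
Definition qscale (F : perfectSemifieldType) (t : rat) (X : F) : F :=
  xget 0 [set Y | Y *~ denq t = X *~ numq t].

Section PerfectSemifieldTheory.
Variable F : perfectSemifieldType.
Implicit Types X Y Z : F.

Lemma addr_oplusl : left_distributive (+%R : F -> F -> F) (@oplus F).
Proof. by move=> X Y Z; rewrite ![_ + Z]addrC addr_oplusr. Qed.

Lemma sle_trans Y X Z : X ⊑ Y -> Y ⊑ Z -> X ⊑ Z.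
Proof. by rewrite /sle => h <-; rewrite oplusA h. Qed.

Lemma sle_addr Z X Y : X ⊑ Y -> X + Z ⊑ Y + Z.
Proof. by rewrite /sle -addr_oplusl => ->. Qed.

Lemma sle_add X Y X' Y' : X ⊑ Y -> X' ⊑ Y' -> X + X' ⊑ Y + Y'.
Proof.
move=> h h'; apply: sle_trans (sle_addr X' h) _.
by rewrite ![Y + _]addrC; exact: sle_addr.
Qed.

Lemma sle_opp X Y : X ⊑ Y -> - Y ⊑ - X.
Proof.
move=> /(sle_addr (- X - Y)).
by rewrite addrA subrr add0r [- X - Y]addrC addNKr.
Qed.

Let ladder X k : F := iter k (fun S => 0 ⊕ (X + S)) 0.

Let ladderS X k : ladder X k.+1 = ladder X k ⊕ X *+ k.+1.
Proof.
elim: k => [|k IHk]; first by rewrite /ladder /= addr0.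
rewrite /ladder iterS -/(ladder X k.+1) [in LHS]IHk addr_oplusr -mulrS.
by rewrite oplusA.
Qed.

Lemma mulrn_eq0_sf n X : (0 < n)%N -> X *+ n = 0 -> X = 0.
Proof.
case: n => // n _ Xn0.
have h0 k : 0 ⊕ ladder X k = ladder X k.
  by case: k => [|k]; rewrite /ladder /= ?oplusA oplusxx.
have hl : 0 ⊕ (X + ladder X n) = ladder X n.
  by rewrite -[LHS]/(ladder X n.+1) ladderS Xn0 oplusC h0.
have hr : 0 ⊕ (X + ladder X n) = X + ladder X n.
  case: n Xn0 {hl} => [|n] Xn0.
    by rewrite -[X]mulr1n Xn0 /ladder /= addr0 oplusxx.
  by rewrite ladderS addr_oplusr -mulrS Xn0 oplusC -oplusA oplusxx.
by apply: (@addIr _ (ladder X n)); rewrite add0r -hr.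
Qed.

Lemma mulrz_inj_sf (d : int) X Y : 0 < d -> X *~ d = Y *~ d -> X = Y.
Proof.
case: d => // n n0 /eqP; rewrite -subr_eq0 -mulrzBl -pmulrn => /eqP h.
by apply/subr0_eq/(mulrn_eq0_sf n0 h).
Qed.

Lemma qscaleP (t : rat) X : qscale t X *~ denq t = X *~ numq t.
Proof.
rewrite /qscale; case: xgetP => [Y -> //|] noY; exfalso.
have /gtz0_abs dE : 0 < denq t by exact: denq_gt0.
have [Y YE] := @mulrn_surj F `|denq t|%N ltac:(by rewrite absz_gt0 denq_neq0)
  (X *~ numq t).
by apply: (noY Y) => /=; rewrite -dE -pmulrn.
Qed.

Lemma qscale_unique (t : rat) (p q : int) X Y : 0 < q ->
  t = p%:~R / q%:~R -> Y *~ q = X *~ p -> Y = qscale t X.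
Proof.
move=> q0 tE h; apply: (@mulrz_inj_sf (q * denq t)).
  by rewrite mulr_gt0 // denq_gt0.
have pq : p * denq t = q * numq t.
  apply: (@intr_inj rat); rewrite !intrM.
  by rewrite numqE {2}tE mulrA [q%:~R * _]mulrC mulfVK // intr_eq0 gt_eqF.
rewrite mulrzA h -mulrzA pq [q * denq t]mulrC [RHS]mulrzA qscaleP.
by rewrite -mulrzA mulrC.
Qed.

Lemma qscale0 X : qscale 0 X = 0.
Proof. by apply/esym/(@qscale_unique 0 0 1). Qed.

Lemma qscaleD (s t : rat) X : qscale (s + t) X = qscale s X + qscale t X.
Proof.
apply/esym/(@qscale_unique (s + t)
  (numq s * denq t + numq t * denq s) (denq s * denq t)).
- by rewrite mulr_gt0 // denq_gt0.
- by rewrite -[in LHS](divq_num_den s) -[in LHS](divq_num_den t) addf_div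
    ?intr_eq0 ?denq_neq0 // intrD !intrM.
- rewrite mulrzDl mulrzA qscaleP [denq s * denq t]mulrC [in X in _ + X]mulrzA.
  by rewrite qscaleP -!mulrzA -mulrzDr.
Qed.

End PerfectSemifieldTheory.

Section Radius.
Variables (R : realType) (F : perfectSemifieldType).
Implicit Types E X Y : F.

Definition is_bound E X (t : rat) : Prop :=
  0 <= t /\ (- qscale t E ⊑ X) /\ (X ⊑ qscale t E).

Definition order_unit E : Prop := forall X, exists t : rat, is_bound E X t.

(* Extended-real valued so that it needs no hypothesis on [E]; it is finite as
   soon as [E] is an order unit (see [order_radius_fin_num]). *)
Definition order_radius E X : \bar R :=
  ereal_inf [set (ratr t : R)%:E | t in is_bound E X].

Lemma order_radius_fin_num E X : order_unit E -> order_radius E X \is a fin_num.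
Proof.
move=> /(_ X) [t tX]; rewrite ge0_fin_numE.
  apply: le_lt_trans (ltry (ratr t : R)).
  by apply: ereal_inf_lbound; exists t.
by apply: le_ereal_inf_tmp => _ [s [s0 _] <-]; rewrite lee_fin ler0q.
Qed.

Lemma order_radius_ltP E X (e : R) :
  (order_radius E X < e%:E)%E <-> exists2 t : rat, is_bound E X t & ratr t < e.
Proof.
split=> [/ereal_inf_lt [_ [t tX <-]]|[t tX te]].
  by rewrite lte_fin => te; exists t.
apply: le_lt_trans (_ : ((ratr t : R)%:E < _)%E); last by rewrite lte_fin.
by apply: ereal_inf_lbound; exists t.
Qed.

End Radius.

(* A copy of [F] with the distance [order_radius E (X - Y)]. *)
Definition radius_space (R : realType) (F : perfectSemifieldType) (E : F) : Type
  := F.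

Section RadiusSpace.
Variables (R : realType) (F : perfectSemifieldType) (E : F).
Local Notation M := (radius_space R E).

HB.instance Definition _ := GRing.Zmodule.on M.

Definition radius_ball (X : M) (e : R) : set M :=
  [set Y : M | (order_radius R E ((X : F) - (Y : F))%R < e%:E)%E].

Let ent : set_system (M * M) := entourage_ radius_ball.

HB.instance Definition _ := hasNbhs.Build M (nbhs_ ent).

Lemma radius_ball_center (X : M) (e : R) : 0 < e -> radius_ball X e X.
Proof.
move=> e0; apply/order_radius_ltP; exists 0; last by rewrite rmorph0.
by rewrite /is_bound qscale0 subrr oppr0 /sle oplusxx.
Qed.

Lemma radius_ball_sym (X Y : M) (e : R) :
  radius_ball X e Y -> radius_ball Y e X.
Proof.
move=> /order_radius_ltP [t [t0 [h1 h2]] te].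
apply/order_radius_ltP; exists t => //.
by split=> //; rewrite -opprB; split; [|rewrite -[qscale t E]opprK];
  exact: sle_opp.
Qed.

Lemma radius_ball_triangle (X Y Z : M) (e1 e2 : R) :
  radius_ball X e1 Y -> radius_ball Y e2 Z -> radius_ball X (e1 + e2) Z.
Proof.
move=> /order_radius_ltP [s [s0 [h1 h2]] se].
move=> /order_radius_ltP [t [t0 [h3 h4]] te].
apply/order_radius_ltP; exists (s + t); last by rewrite rmorphD ltrD.
split; first exact: addr_ge0.
have -> : (X : F) - (Z : F) = ((X : F) - (Y : F)) + ((Y : F) - (Z : F)).
  by rewrite addrA subrK.
by rewrite qscaleD; split; [rewrite opprD|]; exact: sle_add.
Qed.

HB.instance Definition _ := @Nbhs_isPseudoMetric.Build R M
  ent erefl radius_ball radius_ball_center radius_ball_sym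
  radius_ball_triangle erefl.

End RadiusSpace.

(* The case [F = {0}] is not excluded here. *)
Record banach_semifield (R : realType) (F : perfectSemifieldType) (E : F) : Prop
  := BanachSemifield {
  banach_order_unit : order_unit E ;
  banach_order_radius_eq0 : forall X : F, order_radius R E X = 0%E <-> X = 0 ;
  banach_complete : forall G : set_system (radius_space R E),
    ProperFilter G -> cauchy G -> exists X : radius_space R E, G --> X
}.

Record character (R : realType) (F : perfectSemifieldType) (phi : F -> R) : Prop
  := Character {
  character_neq0 : exists X, phi X != 0 ;
  character_oplus : forall X Y, phi (X ⊕ Y) = Num.max (phi X) (phi Y) ;
  characterD : forall X Y, phi (X + Y) = phi X + phi Y
}.

Record spectrum (R : realType) (F : perfectSemifieldType) (E : F) := Spectrum {
  spectrum_fun :> F -> R ;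
  spectrum_char : character spectrum_fun ;
  spectrum_unit : spectrum_fun E = 1
}.

Section SpectrumTopology.
Variables (R : realType) (F : perfectSemifieldType) (E : F).
Local Notation S := (spectrum R E).

HB.instance Definition _ := gen_eqMixin S.
HB.instance Definition _ := gen_choiceMixin S.

(* The weakest topology making all evaluations continuous. *)
HB.instance Definition _ := Topological.copy S
  (sup_topology (fun X : F =>
    Topological.on (initial_topology (fun phi : S => phi X)))).

Lemma eval_continuous (X : F) : continuous (fun phi : S => phi X).
Proof.
move=> phi.
pose f psi : R := (psi : S) X.
have h : nbhs phi `=>` nbhs (phi : initial_topology f).
  have [/(_ (fun A hA => hA)) cvgphi _] := @cvg_sup S F (fun Y : F =>
    Topological.on (initial_topology (fun psi : S => psi Y))) (nbhs phi) phi _.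
  exact: cvgphi X.
move=> A hA; apply: h.
exact: (@initial_continuous S R f phi A hA).
Qed.

Definition Theta (X : F) : continuousType S R := mkcts (@eval_continuous X).

End SpectrumTopology.
Arguments Theta R {F} E X.

(* [C^0(K, R)] with the pointwise maximum and addition. *)
Section ContinuousFunctions.
Variables (R : realType) (K : topologicalType).
Local Notation C := (continuousType K R).
Implicit Types f g h : C.

Let add_cts f g : continuous (fun x => f x + g x).
Proof. by move=> x; apply: cvgD; exact: cts_fun. Qed.
Let opp_cts f : continuous (fun x => - f x).
Proof. by move=> x; apply: cvgN; exact: cts_fun. Qed.
Let max_cts f g : continuous (fun x => Num.max (f x) (g x)).
Proof. by move=> x; apply: continuous_max; exact: cts_fun. Qed.
Let scale_cts (a : R) f : continuous (fun x => a * f x).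
Proof. by move=> x; apply: cvgMr; exact: cts_fun. Qed.

Definition cts_zero : C := cst 0.
Definition cts_one : C := cst 1.
Definition cts_add f g : C := mkcts (@add_cts f g).
Definition cts_opp f : C := mkcts (@opp_cts f).
Definition cts_max f g : C := mkcts (@max_cts f g).

Let cts_addA : associative cts_add.
Proof. by move=> f g h; apply/continuousEP => x; exact: addrA. Qed.
Let cts_addC : commutative cts_add.
Proof. by move=> f g; apply/continuousEP => x; exact: addrC. Qed.
Let cts_add0 : left_id cts_zero cts_add.
Proof. by move=> f; apply/continuousEP => x; exact: add0r. Qed.
Let cts_addN : left_inverse cts_zero cts_opp cts_add.
Proof. by move=> f; apply/continuousEP => x; exact: addNr. Qed.

HB.instance Definition _ :=
  GRing.isZmodule.Build C cts_addA cts_addC cts_add0 cts_addN.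

Lemma cts_mulrnE f n x : (f *+ n) x = f x *+ n.
Proof. by elim: n => [//|n IHn]; rewrite !mulrS -IHn. Qed.

Let cts_maxA : associative cts_max.
Proof. by move=> f g h; apply/continuousEP => x; exact: maxA. Qed.
Let cts_maxC : commutative cts_max.
Proof. by move=> f g; apply/continuousEP => x; exact: maxC. Qed.
Let cts_maxxx : idempotent_op cts_max.
Proof. by move=> f; apply/continuousEP => x; exact: maxxx. Qed.
Let cts_add_maxr : right_distributive (+%R : C -> C -> C) cts_max.
Proof. by move=> f g h; apply/continuousEP => x; exact: addr_maxr. Qed.
Let cts_mulrn_surj (n : nat) : (0 < n)%N ->
  forall g, exists f, f *+ n = g.
Proof.
move=> n0 g; exists (mkcts (@scale_cts n%:R^-1 g)); apply/continuousEP => x.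
rewrite cts_mulrnE /mkcts /= -mulrnAl -[X in X * _]mulr_natr mulVf ?mul1r //.
by rewrite pnatr_eq0 -lt0n.
Qed.

HB.instance Definition _ := isPerfectSemifield.Build C
  cts_maxA cts_maxC cts_maxxx cts_add_maxr cts_mulrn_surj.

End ContinuousFunctions.
Arguments cts_one : clear implicits.

(* Boolean-valued, so that the generic quotient [{eq_quot _}] applies; in the
   classical setting this is no restriction on the relation. *)
Record congruence (F : perfectSemifieldType) := Congruence {
  cong_rel :> equiv_rel F ;
  cong_opp : forall X Y, cong_rel X Y -> cong_rel (- X) (- Y) ;
  cong_add : forall X Y Z, cong_rel X Y -> cong_rel (X + Z) (Y + Z) ;
  cong_oplus : forall X Y Z, cong_rel X Y -> cong_rel (X ⊕ Z) (Y ⊕ Z)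
}.

Definition closed_congruence (R : realType) (F : perfectSemifieldType) (E : F)
    (c : congruence F) : Prop :=
  closed [set p : radius_space R E * radius_space R E | c p.1 p.2].

Section QuotientSemifield.
Variables (F : perfectSemifieldType) (c : congruence F).

Definition cong_quot : Type := {eq_quot c}.
Local Notation Q := cong_quot.

HB.instance Definition _ := Choice.on Q.
HB.instance Definition _ := EqQuotient.on Q.

Definition quot_zero : Q := lift_cst Q 0.
Definition quot_opp := lift_op1 Q -%R.
Definition quot_add := lift_op2 Q +%R.
Definition quot_oplus := lift_op2 Q (@oplus F).

Lemma cong_quotP (X Y : F) : c X Y <-> \pi_Q X = \pi_Q Y.
Proof. by split=> [h|/eqP]; [apply/eqP|]; rewrite piE. Qed.

Let cong_repr (X : F) : c (repr (\pi_Q X)) X.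
Proof. by apply/cong_quotP; rewrite reprK. Qed.

Lemma pi_quot_opp : {morph \pi_Q : X / - X >-> quot_opp X}.
Proof.
move=> X; unlock quot_opp; apply/esym/cong_quotP; exact/cong_opp/cong_repr.
Qed.

Lemma pi_quot_add : {morph \pi_Q : X Y / X + Y >-> quot_add X Y}.
Proof.
move=> X Y; unlock quot_add; apply/esym.
transitivity (\pi_Q (X + repr (\pi_Q Y))).
  by apply/cong_quotP/cong_add/cong_repr.
by rewrite ![X + _]addrC; apply/cong_quotP/cong_add/cong_repr.
Qed.

Lemma pi_quot_oplus : {morph \pi_Q : X Y / X ⊕ Y >-> quot_oplus X Y}.
Proof.
move=> X Y; unlock quot_oplus; apply/esym.
transitivity (\pi_Q (X ⊕ repr (\pi_Q Y))).
  by apply/cong_quotP/cong_oplus/cong_repr.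
by rewrite ![X ⊕ _]oplusC; apply/cong_quotP/cong_oplus/cong_repr.
Qed.

Let pi_quot_zero : \pi_Q 0 = quot_zero.
Proof. by unlock quot_zero. Qed.

Let quot_addA : associative quot_add.
Proof.
elim/quotW => X; elim/quotW => Y; elim/quotW => Z.
by rewrite -!pi_quot_add addrA.
Qed.
Let quot_addC : commutative quot_add.
Proof.
by elim/quotW => X; elim/quotW => Y; rewrite -!pi_quot_add addrC.
Qed.
Let quot_add0 : left_id quot_zero quot_add.
Proof. by elim/quotW => X; rewrite -pi_quot_zero -pi_quot_add add0r. Qed.
Let quot_addN : left_inverse quot_zero quot_opp quot_add.
Proof.
by elim/quotW => X; rewrite -pi_quot_zero -pi_quot_opp -pi_quot_add addNr.
Qed.

HB.instance Definition _ :=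
  GRing.isZmodule.Build Q quot_addA quot_addC quot_add0 quot_addN.
HB.instance Definition _ :=
  @isZmodQuotient.Build F c 0 -%R +%R Q pi_quot_zero pi_quot_opp pi_quot_add.

Let quot_oplusA : associative quot_oplus.
Proof.
elim/quotW => X; elim/quotW => Y; elim/quotW => Z.
by rewrite -!pi_quot_oplus oplusA.
Qed.
Let quot_oplusC : commutative quot_oplus.
Proof.
by elim/quotW => X; elim/quotW => Y; rewrite -!pi_quot_oplus oplusC.
Qed.
Let quot_oplusxx : idempotent_op quot_oplus.
Proof. by elim/quotW => X; rewrite -pi_quot_oplus oplusxx. Qed.
Let quot_addr_oplusr : right_distributive (+%R : Q -> Q -> Q) quot_oplus.
Proof.
elim/quotW => X; elim/quotW => Y; elim/quotW => Z.
by rewrite -pi_quot_oplus -!pi_addr -pi_quot_oplus addr_oplusr.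
Qed.
Let quot_mulrn_surj (n : nat) : (0 < n)%N ->
  forall Y : Q, exists X : Q, X *+ n = Y.
Proof.
move=> n0; elim/quotW => Y; have [X <-] := mulrn_surj n n0 Y.
by exists (\pi_Q X); rewrite raddfMn.
Qed.

HB.instance Definition _ := isPerfectSemifield.Build Q
  quot_oplusA quot_oplusC quot_oplusxx quot_addr_oplusr quot_mulrn_surj.

Lemma pi_oplus : {morph \pi_Q : X Y / X ⊕ Y >-> X ⊕ Y}.
Proof. exact: pi_quot_oplus. Qed.

End QuotientSemifield.

Section SpectrumOfQuotient.
Variables (R : realType) (F : perfectSemifieldType) (E : F) (c : congruence F).
Local Notation Q := (cong_quot c).

Let pullback_char (phi : spectrum R (\pi_Q E)) : character (phi \o \pi_Q).
Proof.
split=> [|X Y|X Y] /=.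
- exists E; rewrite /= spectrum_unit; exact: oner_neq0.
- by rewrite pi_oplus (character_oplus (spectrum_char phi)).
- by rewrite pi_addr (characterD (spectrum_char phi)).
Qed.

Definition spectrum_pullback (phi : spectrum R (\pi_Q E)) : spectrum R E :=
  Spectrum (pullback_char phi) (spectrum_unit phi).

End SpectrumOfQuotient.

(* [m] is the maximum of [g], with the convention that the maximum over an
   empty type is [0]. *)
Definition is_max0 (R : realType) (T : Type) (g : T -> R) (m : R) : Prop :=
  (range g m /\ ubound (range g) m) \/ (range g = set0 /\ m = 0).

(* Main.v *)
(* For a closed congruence the quotient is again Banach: truncating a lift of
   [V] to an interval [[- t E, t E]] shows that [r_~ V] is the infimum of [r]
   over the fibre of [V]; closedness then gives [r_~ V = 0 -> V = 0], and a
   Cauchy sequence lifts step by step to a Cauchy sequence.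

   It remains to show that a Banach semi-field is isometric to the continuous
   functions on its spectrum.  Characters with [phi E = 1] correspond to the
   maximal sets [{X | phi X <= 0}] among the downward closed sets, stable under
   both laws, that do not contain [E]; by Zorn's lemma there are enough of them
   for [r X = max |phi X|].  The spectrum is compact as a closed subspace of a
   product of intervals, the lattice version of the Stone-Weierstrass theorem
   makes the image of [Theta] dense, and completeness makes it everything. *)
Require Import Defs.
From mathcomp Require Import all_boot all_order all_algebra.
From mathcomp Require Import all_classical all_reals all_analysis.
From mathcomp Require Import ring lra.
Set Implicit Arguments.
Unset Strict Implicit.
Unset Printing Implicit Defensive.
Import Order.TTheory GRing.Theory Num.Theory.
Import numFieldNormedType.Exports.
Local Open Scope classical_set_scope.
Local Open Scope ring_scope.
Local Open Scope quotient_scope.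
Local Open Scope semifield_scope.

(** * The order of a semi-field *)

Section Order.
Variable F : perfectSemifieldType.
Implicit Types X Y Z D E : F.

Lemma sle_refl X : X ⊑ X.
Proof. exact: oplusxx. Qed.

Lemma sle_antisym {X Y} : X ⊑ Y -> Y ⊑ X -> X = Y.
Proof. by rewrite /sle oplusC => -> ->. Qed.

Lemma sle_oplusl X Y : X ⊑ X ⊕ Y.
Proof. by rewrite /sle oplusA oplusxx. Qed.

Lemma sle_oplusr X Y : Y ⊑ X ⊕ Y.
Proof. by rewrite oplusC; exact: sle_oplusl. Qed.

Lemma oplus_sle {X Y Z} : X ⊑ Z -> Y ⊑ Z -> X ⊕ Y ⊑ Z.
Proof. by rewrite /sle -oplusA => hX ->. Qed.

Lemma sle_subr X Y Z : X ⊑ Y + Z -> X - Z ⊑ Y.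
Proof. by move=> /(sle_addr (- Z)); rewrite addrK. Qed.

Lemma sle_subl X Y Z : X - Z ⊑ Y -> X ⊑ Y + Z.
Proof. by move=> /(sle_addr Z); rewrite subrK. Qed.

Lemma sle_subr_ge0 X Y : X ⊑ Y -> 0 ⊑ Y - X.
Proof. by move=> /(sle_addr (- X)); rewrite subrr. Qed.

Lemma sle_oppl X Y : - X ⊑ Y -> - Y ⊑ X.
Proof. by move=> /sle_opp; rewrite opprK. Qed.

Lemma sle_oppr X Y : X ⊑ - Y -> Y ⊑ - X.
Proof. by move=> /sle_opp; rewrite opprK. Qed.

Lemma addr_sge0 X Y : 0 ⊑ X -> 0 ⊑ Y -> 0 ⊑ X + Y.
Proof. by move=> hX hY; rewrite -[0]addr0; exact: sle_add. Qed.

Lemma sle_addr_ge0 X Y : 0 ⊑ Y -> X ⊑ X + Y.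
Proof. by move=> /(sle_addr X); rewrite add0r addrC. Qed.

Lemma sle_addl_ge0 X Y : 0 ⊑ Y -> X ⊑ Y + X.
Proof. by move=> /(sle_addr X); rewrite add0r. Qed.

Lemma mulrn_sge0 X n : 0 ⊑ X -> 0 ⊑ X *+ n.
Proof.
move=> hX; elim: n => [|n IHn]; first exact: sle_refl.
by rewrite mulrS; exact: addr_sge0.
Qed.

Lemma sle_mulrn X n : 0 ⊑ X -> (0 < n)%N -> X ⊑ X *+ n.
Proof.
case: n => // n X0 _; rewrite mulrSr.
exact/sle_addl_ge0/mulrn_sge0.
Qed.

Lemma sle_mulrn2 X Y n : X ⊑ Y -> X *+ n ⊑ Y *+ n.
Proof.
move=> h; elim: n => [|n IHn]; first exact: sle_refl.
by rewrite !mulrS; exact: sle_add.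
Qed.

(* For positive elements this says that the infimum of [X] and [Y] is [0]. *)
Definition sdisjoint X Y := forall D, D ⊑ X -> D ⊑ Y -> D ⊑ 0.

Lemma sdisjointC {X Y} : sdisjoint X Y -> sdisjoint Y X.
Proof. by move=> h D hX hY; exact: h. Qed.

(** If [D] lies below [X] and [Y + Z], then [D - Z] lies below [Y], and below [X] because [Z] is
    positive. So [D ⊑ Z], and the second disjointness applies. *)
Lemma sdisjointD X Y Z : 0 ⊑ Z ->
  sdisjoint X Y -> sdisjoint X Z -> sdisjoint X (Y + Z).
Proof.
move=> Z0 hY hZ D DX /sle_subr DY; apply: hZ => //.
rewrite -[Z]add0r; apply: sle_subl; apply: hY => //.
by apply: sle_trans DX; apply: sle_subr; exact: sle_addr_ge0.
Qed.

Lemma sdisjoint_mulrn X Y n : 0 ⊑ Y -> sdisjoint X Y -> sdisjoint X (Y *+ n).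
Proof.
move=> Y0 h; elim: n => [|n IHn]; first by move=> D _.
by rewrite mulrSr; exact: sdisjointD.
Qed.

(** Since X⁺ - X = (-X)⁺, a common lower bound [D] satisfies X ⊑ X⁺ - D and 0 ⊑ X⁺ - D, hence X⁺ ⊑
    X⁺ - D. *)
Lemma sdisjoint_pos_neg X : sdisjoint (X ⊕ 0) (- X ⊕ 0).
Proof.
have posE : X ⊕ 0 - X = - X ⊕ 0 by rewrite addr_oplusl subrr add0r oplusC.
move=> D DX; rewrite -posE => /(sle_addr X); rewrite subrK => DpX.
have : X ⊕ 0 ⊑ X ⊕ 0 - D.
  apply: oplus_sle; last exact: sle_subr_ge0.
  by have /(sle_addr (- D)) := DpX; rewrite [D + X]addrC addrK.
move=> /(sle_addr (- (X ⊕ 0))); rewrite subrr addrAC subrr add0r.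
by move=> /sle_oppr; rewrite oppr0.
Qed.

Lemma pos_sub_neg X : X = X ⊕ 0 - (- X ⊕ 0).
Proof.
by apply/eqP; rewrite eq_sym subr_eq addrC addr_oplusl addNr add0r oplusC.
Qed.

(** The hypothesis reads n (-X)⁺ ⊑ n X⁺. These two are disjoint, so n (-X)⁺ ⊑ 0, and the absence of
    torsion gives (-X)⁺ = 0. *)
Lemma sge0_mulrn X n : (0 < n)%N -> 0 ⊑ X *+ n -> 0 ⊑ X.
Proof.
move=> n0 Xn0; set b := - X ⊕ 0.
have b0 : 0 ⊑ b by exact: sle_oplusr.
have a0 : 0 ⊑ X ⊕ 0 by exact: sle_oplusr.
have bn0 : b *+ n ⊑ 0.
  have /(sdisjoint_mulrn (n := n) b0)/sdisjointC
    /(sdisjoint_mulrn (n := n) a0) :=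
    @sdisjoint_pos_neg X.
  apply; first exact: sle_refl.
  move: Xn0; rewrite [X in X *+ n]pos_sub_neg mulrnBl => /(sle_addr (b *+ n)).
  by rewrite add0r subrK.
have -> : X = X ⊕ 0.
  rewrite [LHS]pos_sub_neg -/b.
  have -> : b = 0 by apply: mulrn_eq0_sf n0 _; apply: sle_antisym => //;
    exact: mulrn_sge0.
  by rewrite subr0.
exact: sle_oplusr.
Qed.

Lemma qscale_nat (t : rat) X : 0 <= t ->
  qscale t X *+ `|denq t|%N = X *+ `|numq t|%N.
Proof.
move=> t0; have := qscaleP t X.
have -> : denq t = `|denq t|%N by rewrite gtz0_abs ?denq_gt0.
by have -> : numq t = `|numq t|%N by rewrite gez0_abs ?numq_ge0.
Qed.

Lemma qscale_ge0 (t : rat) X : 0 <= t -> 0 ⊑ X -> 0 ⊑ qscale t X.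
Proof.
move=> t0 X0; apply: (@sge0_mulrn _ `|denq t|%N).
  by rewrite absz_gt0 denq_neq0.
by rewrite qscale_nat //; exact: mulrn_sge0.
Qed.

Lemma qscale_ge0_inv (t : rat) X : 0 < t -> 0 ⊑ qscale t X -> 0 ⊑ X.
Proof.
move=> t0 /(mulrn_sge0 `|denq t|%N); rewrite qscale_nat ?ltW // => h.
by apply: sge0_mulrn h; rewrite absz_gt0 numq_eq0 gt_eqF.
Qed.

Lemma qscaleN (t : rat) X : qscale (- t) X = - qscale t X.
Proof. by apply/eqP; rewrite -addr_eq0 -qscaleD addNr qscale0. Qed.

Lemma qscale_opp (t : rat) X : qscale t (- X) = - qscale t X.
Proof.
by apply: (mulrz_inj_sf (denq_gt0 t)); rewrite qscaleP !mulNrz qscaleP.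
Qed.

Lemma qscale1 X : qscale 1 X = X.
Proof. by apply/esym/(@qscale_unique _ 1 1 1). Qed.

Lemma qscale_le (s t : rat) X : 0 ⊑ X -> s <= t -> qscale s X ⊑ qscale t X.
Proof.
move=> X0 st; rewrite -(subrK s t) qscaleD.
by apply/sle_addl_ge0/qscale_ge0 => //; rewrite subr_ge0.
Qed.

Lemma order_unit_ge0 E : order_unit E -> 0 ⊑ E.
Proof.
move=> /(_ E) [t [t0 [h _]]]; apply: (@qscale_ge0_inv (1 + t)).
  by rewrite ltr_wpDr.
by move: h => /(sle_addr (qscale t E)); rewrite addNr qscaleD qscale1.
Qed.

(** Covers the degenerate quotient, whose spectrum is empty. *)
Lemma order_unit_le0 E : order_unit E -> E ⊑ 0 -> forall X, X = 0.
Proof.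
move=> Eu E_le0 X; have E0 : E = 0 by apply/(sle_antisym E_le0)/order_unit_ge0.
have [t [_ []]] := Eu X.
have -> : qscale t E = 0.
  apply: (mulrz_inj_sf (denq_gt0 t)).
  by rewrite qscaleP E0 !mul0rz.
by rewrite oppr0 => ? ?; exact: sle_antisym.
Qed.

End Order.

Section Radius.
Variables (R : realType) (F : perfectSemifieldType) (E : F).
Implicit Types X : F.

Lemma order_radius_ge0 X : (0 <= order_radius R E X)%E.
Proof.
by apply: le_ereal_inf_tmp => _ [s [s0 _] <-]; rewrite lee_fin ler0q.
Qed.

Lemma order_radius_0 : order_radius R E 0 = 0%E.
Proof.
apply/eqP; rewrite eq_le order_radius_ge0 andbT.
apply: ereal_inf_lbound; exists 0; last by rewrite rmorph0.
by rewrite /is_bound qscale0 oppr0 /sle oplusxx.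
Qed.

End Radius.

(** * Surjective morphisms and the radius *)

Section SurjectiveMorphism.
Variables (R : realType) (F F' : perfectSemifieldType) (h : F -> F') (E : F).
Hypotheses (h_oplus : {morph h : X Y / X ⊕ Y}) (hD : {morph h : X Y / X + Y}).
Hypothesis h_surj : forall V, exists X, h X = V.
Hypothesis Eu : order_unit E.
Implicit Types X Y : F.

Lemma morph_sf0 : h 0 = 0.
Proof. by apply: (@addIr _ (h 0)); rewrite -hD !add0r. Qed.

Lemma morph_sfN X : h (- X) = - h X.
Proof. by apply: (@addIr _ (h X)); rewrite -hD !addNr morph_sf0. Qed.

Lemma morph_sfB X Y : h (X - Y) = h X - h Y.
Proof. by rewrite hD morph_sfN. Qed.

Lemma morph_sfMn X n : h (X *+ n) = h X *+ n.
Proof. by elim: n => [|n IHn]; rewrite ?morph_sf0 // !mulrS hD IHn. Qed.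

Lemma morph_sfMz X n : h (X *~ n) = h X *~ n.
Proof.
by case: n => n; rewrite ?NegzE ?mulrNz ?morph_sfN -!pmulrn morph_sfMn.
Qed.

Lemma morph_sf_qscale t X : h (qscale t X) = qscale t (h X).
Proof.
apply: (@qscale_unique _ t (numq t) (denq t)); rewrite ?divq_num_den //.
by rewrite -!morph_sfMz qscaleP.
Qed.

Lemma morph_sf_le X Y : X ⊑ Y -> h X ⊑ h Y.
Proof. by rewrite /sle -h_oplus => ->. Qed.

Lemma is_bound_morph X t : is_bound E X t -> is_bound (h E) (h X) t.
Proof.
case=> t0 [h1 h2]; split=> //; rewrite -morph_sf_qscale -morph_sfN.
by split; exact: morph_sf_le.
Qed.

(* Truncating any lift of [V] to the interval [[- t E, t E]]. *)
Lemma is_bound_lift V t : is_bound (h E) V t ->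
  exists2 X, h X = V & is_bound E X t.
Proof.
case=> t0 [h1 h2]; have [X hX] := h_surj V.
pose T := qscale t E; have T0 : 0 ⊑ T.
  by apply: qscale_ge0 => //; exact: order_unit_ge0.
exists (- (- (X ⊕ - T) ⊕ - T)).
  rewrite morph_sfN h_oplus !morph_sfN h_oplus morph_sfN morph_sf_qscale hX.
  have -> : V ⊕ - qscale t (h E) = V by rewrite oplusC; exact: h1.
  have -> : - V ⊕ - qscale t (h E) = - V.
    by rewrite oplusC; apply: sle_opp.
  by rewrite opprK.
split=> //; split.
  apply: sle_opp; apply: oplus_sle; last first.
    apply: (@sle_trans _ 0) => //.
    by have := sle_opp T0; rewrite oppr0.
  by apply: sle_oppl; exact: sle_oplusr.
by apply: sle_oppl; exact: sle_oplusr.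
Qed.

Lemma order_unit_morph : order_unit (h E).
Proof.
move=> V; have [X <-] := h_surj V.
by have [t /is_bound_morph tX] := Eu X; exists t.
Qed.

Lemma order_radius_lift V (e : R) : (order_radius R (h E) V < e%:E)%E ->
  exists2 X, h X = V & (order_radius R E X < e%:E)%E.
Proof.
move=> /order_radius_ltP [t /is_bound_lift [X hX tX] te].
by exists X => //; apply/order_radius_ltP; exists t.
Qed.

Lemma order_radius_morph_le X :
  (order_radius R (h E) (h X) <= order_radius R E X)%E.
Proof.
apply: ereal_inf_le_tmp => _ [t tX <-].
by exists t => //; exact: is_bound_morph.
Qed.

(** A morphism does not increase the radius, and truncation lifts every bound without loss. This
    serves for the projection and, with one-point fibres, for the evaluation map of the quotient. *)
Lemma order_radius_fibre V :
  ereal_inf (order_radius R E @` [set X | h X = V]) = order_radius R (h E) V.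
Proof.
apply/eqP; rewrite eq_le; apply/andP; split; last first.
  by apply: le_ereal_inf_tmp => _ [X <- <-]; exact: order_radius_morph_le.
apply: le_ereal_inf_tmp => _ [t /is_bound_lift [X hX tX] <-].
apply: (@le_trans _ _ (order_radius R E X)).
  by apply: ereal_inf_lbound; exists X.
by apply: ereal_inf_lbound; exists t.
Qed.

End SurjectiveMorphism.

(** * Completeness of images *)

Section CompleteMorphism.
Variables (R : realType) (F F' : perfectSemifieldType) (h : F -> F') (E : F).
Hypotheses (h_oplus : {morph h : X Y / X ⊕ Y}) (hD : {morph h : X Y / X + Y}).
Hypothesis h_surj : forall V, exists X, h X = V.
Hypothesis Eu : order_unit E.
Local Notation M := (radius_space R E).
Local Notation M' := (radius_space R (h E)).

Lemma ball_morph (X Y : M) (e : R) : ball X e Y ->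
  ball (h X : M') e (h Y : M').
Proof.
move=> XY; apply: le_lt_trans XY.
rewrite -(morph_sfB hD); exact: order_radius_morph_le.
Qed.

(** Subtract from [X] a lift of [h X - V] whose radius obeys the same strict bound. *)
Lemma ball_lift (X : F) (V : M') (e : R) : ball (h X : M') e V ->
  exists Y : F, h Y = V /\ ball (X : M) e (Y : M).
Proof.
move=> XV; have [Z hZ Ze] := order_radius_lift h_oplus hD h_surj Eu XV.
exists (X - Z); rewrite (morph_sfB hD) hZ opprB addrC subrK; split=> //.
suff : (order_radius R E (X - (X - Z))%R < e%:E)%E by [].
by rewrite opprB addrC subrK.
Qed.

(** The steps add up to 4·2^-n (1 - 2^-k). One more 4·2^-n keeps the radius positive at [k = 0], as
    balls are open; the total stays below 8·2^-n. *)
Lemma cauchy_steps (Y : nat -> M) :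
  (forall n, ball (Y n) (2 * 2^-1 ^+ n) (Y n.+1)) ->
  forall n k, ball (Y n) (4 * 2^-1 ^+ n * (2 - 2^-1 ^+ k)) (Y (n + k)%N).
Proof.
move=> hY n; elim=> [|k IHk].
  rewrite addn0 expr0; apply: ballxx.
  by have : 0 < 2^-1 ^+ n :> R; [rewrite exprn_gt0|lra].
have := ball_triangle IHk (hY _); rewrite addnS; apply: le_ball.
rewrite exprD exprS; set a := 2^-1 ^+ n; set b := 2^-1 ^+ k.
by rewrite le_eqVlt; apply/orP; left; apply/eqP; field.
Qed.

Lemma complete_morph :
  (forall G : set_system M, ProperFilter G -> cauchy G ->
    exists X : M, G --> X) ->
  forall G : set_system M', ProperFilter G -> cauchy G ->
    exists V : M', G --> V.
Proof.
move=> F_complete G PG /cauchyP Gc.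
have h0 n : 0 < 2^-1 ^+ n :> R by rewrite exprn_gt0.
(* [V n] is only the centre of a ball of radius 2^-n that belongs to [G]; consecutive balls meet. *)
have /choice [V GV] n : exists V : M', G (ball V (2^-1 ^+ n)).
  by have [V GV] := Gc _ (h0 n); exists V.
have Vstep n : ball (V n) (2 * 2^-1 ^+ n) (V n.+1).
  have [W [W1 W2]] := @filter_ex _ _ PG _ (filterI (GV n) (GV n.+1)).
  have := ball_triangle W1 (ball_sym W2); apply: le_ball.
  by rewrite exprS; have := h0 n; lra.
(* Stated as an implication over all pairs, the choice gives a total function along which [Y] can
   recurse; the value 0 is a dummy. *)
have /choice [next nextP] (p : nat * M) : exists Y : M,
    h p.2 = V p.1 -> h Y = V p.1.+1 /\ ball p.2 (2 * 2^-1 ^+ p.1) Y.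
  have [e|] := pselect (h p.2 = V p.1); last by exists 0.
  have := Vstep p.1; rewrite -e => /ball_lift [Y hY].
  by exists Y.
have [Y0 hY0] := h_surj (V 0%N).
pose Y := fix Y n : M := if n is m.+1 then next (m, Y m) else Y0.
have hY n : h (Y n) = V n.
  by elim: n => [//|n IHn]; have [] := nextP (n, Y n) IHn.
have Ystep n : ball (Y n) (2 * 2^-1 ^+ n) (Y n.+1).
  by have [] := nextP (n, Y n) (hY n).
have small e : 0 < e -> exists n, 8 * 2^-1 ^+ n < e :> R.
  move=> e0.
  have : 8 * 2^-1 ^+ n @[n --> \oo] --> (0 : R).
    rewrite -[X in _ --> X](mulr0 8); apply: cvgMr; apply: cvg_expr.
    by rewrite ger0_norm ?invf_lt1 ?ltr1n.
  move=> /cvgr_lt /(_ _ e0) [n _ /(_ n (leqnn n))] ?; by exists n.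
have far n m : (n <= m)%N -> ball (Y n) (8 * 2^-1 ^+ n) (Y m).
  move=> /subnKC <-; apply: le_ball (cauchy_steps Ystep n _).
  have := h0 n; have := h0 (m - n)%N; nra.
have [|X YX] := F_complete (Y n @[n --> \oo]) _.
  apply: cauchy_exP => e e0; have [n ne] := small e e0.
  exists (Y n); exists n => // m /= nm; apply: le_ball (far _ _ nm).
  exact: ltW.
exists (h X); apply/cvg_ballP => e e0.
have e2 : 0 < e / 2 by rewrite divr_gt0.
have [N _ YN] := (cvg_ballP _ _).1 YX _ e2.
have [n ne] := small _ e2.
(* Beyond [N], [V m] is within e/2 of [h X]; beyond [n], the ball around [V m] that belongs to [G]
   has radius below e/2. *)
pose m := maxn N n.
have : ball (h X : M') (e / 2) (V m : M').
  by rewrite -hY; apply/ball_morph/YN => /=; exact: leq_maxl.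
move=> hm; apply: filterS (GV m) => W Wm /=.
apply: le_ball (ball_triangle hm Wm).
have : 2^-1 ^+ m <= 2^-1 ^+ n :> R.
  by rewrite ler_wiXn2l ?leq_maxr // ?invf_le1 ?ler1n.
have := h0 n; lra.
Qed.

End CompleteMorphism.

(** * Existence of characters *)

Section Cones.
Variables (F : perfectSemifieldType) (E : F).
Hypothesis Eu : order_unit E.
Implicit Types (X Y A : F) (N : set F).

(* The sets [{X | phi X <= 0}], [phi] a character with [phi E = 1], are the
   maximal such [N]. *)
Record proper_cone N : Prop := ProperCone {
  cone0 : N 0 ;
  cone_down : forall X Y, X ⊑ Y -> N Y -> N X ;
  coneD : forall X Y, N X -> N Y -> N (X + Y) ;
  cone_oplus : forall X Y, N X -> N Y -> N (X ⊕ Y) ;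
  cone_proper : ~ N E
}.

Lemma coneMn N X n : proper_cone N -> N X -> N (X *+ n).
Proof.
move=> Nc NX; elim: n => [|n IHn]; first exact: cone0.
by rewrite mulrS; exact: coneD.
Qed.

Lemma nonpos_proper_cone : ~ E ⊑ 0 -> proper_cone [set X | X ⊑ 0].
Proof.
move=> E0; split=> //= [|X Y|X Y hX hY|X Y].
- exact: sle_refl.
- exact: sle_trans.
- by rewrite -[X in _ ⊑ X]addr0; exact: sle_add.
- exact: oplus_sle.
Qed.

Lemma order_unit_nat X : exists n, X ⊑ E *+ n.
Proof.
have [t [t0 [_ h]]] := Eu X; exists `|numq t|%N.
rewrite -qscale_nat //; apply: sle_trans h _; apply: sle_mulrn.
  by apply: qscale_ge0 => //; exact: order_unit_ge0.
by rewrite absz_gt0 denq_neq0.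
Qed.

(** The cone generated by [N] and [Y]. With [0 ⊑ A] and Y⁺ in place of [Y], the upper bounds are
    positive, so the sum of two of them dominates both; this gives stability under [⊕]. *)
Definition cone_adjoin N Y : set F :=
  [set X | exists A n, [/\ N A, 0 ⊑ A & X ⊑ A + (Y ⊕ 0) *+ n]].

Lemma sub_cone_adjoin N Y : proper_cone N -> N `<=` cone_adjoin N Y.
Proof.
move=> Nc X NX; exists (X ⊕ 0), 0%N; rewrite addr0; split.
- by apply: cone_oplus => //; exact: cone0.
- exact: sle_oplusr.
- exact: sle_oplusl.
Qed.

Lemma mem_cone_adjoin N Y : proper_cone N -> cone_adjoin N Y Y.
Proof.
move=> Nc; exists 0, 1%N; split; [exact: cone0|exact: sle_refl|].
by rewrite add0r; exact: sle_oplusl.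
Qed.

Lemma cone_adjoin_le N Y Z : Y ⊑ Z -> cone_adjoin N Y `<=` cone_adjoin N Z.
Proof.
move=> YZ X [A [n [NA A0 XA]]]; exists A, n; split=> //.
apply: sle_trans XA _; rewrite ![A + _]addrC; apply: sle_addr.
apply: sle_mulrn2; apply: oplus_sle; last exact: sle_oplusr.
by apply: sle_trans YZ _; exact: sle_oplusl.
Qed.

(* If [E ⊑ A + n Y⁺] and [(-Y)⁺ ⊑ m E], then [(-Y)⁺ ⊑ m A + m n Y⁺], hence
   [(-Y)⁺ ⊑ m A] because [Y⁺] and [(-Y)⁺] are disjoint; so [- Y] is in [N]. *)
Lemma cone_adjoin_proper N Y :
  proper_cone N -> ~ N (- Y) -> proper_cone (cone_adjoin N Y).
Proof.
move=> Nc NY; have p0 : 0 ⊑ Y ⊕ 0 by exact: sle_oplusr.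
have addE A A' n n' : A + A' + (Y ⊕ 0) *+ (n + n') =
    (A + (Y ⊕ 0) *+ n) + (A' + (Y ⊕ 0) *+ n').
  by rewrite mulrnDr addrACA.
split.
- by apply: sub_cone_adjoin => //; exact: cone0.
- move=> X Z XZ [A [n [NA A0 ZA]]]; exists A, n; split=> //.
  exact: sle_trans ZA.
- move=> X Z [A [n [NA A0 XA]]] [A' [n' [NA' A0' ZA]]].
  exists (A + A'), (n + n')%N; split; [exact: coneD|exact: addr_sge0|].
  by rewrite addE; exact: sle_add.
- move=> X Z [A [n [NA A0 XA]]] [A' [n' [NA' A0' ZA]]].
  exists (A + A'), (n + n')%N; split; [exact: coneD|exact: addr_sge0|].
  rewrite addE; apply: oplus_sle.
    apply: sle_trans XA _; apply: sle_addr_ge0.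
    by apply: addr_sge0 => //; exact: mulrn_sge0.
  apply: sle_trans ZA _; apply: sle_addl_ge0.
  by apply: addr_sge0 => //; exact: mulrn_sge0.
- move=> [A [n [NA A0 EA]]]; apply: NY.
  have [m YE] := order_unit_nat (- Y ⊕ 0).
  apply: (cone_down Nc _ (coneMn m Nc NA)).
  apply: sle_trans (sle_oplusl (- Y) 0) _; rewrite -[X in _ ⊑ X]add0r.
  apply: sle_subl; have YnY := sdisjointC (@sdisjoint_pos_neg _ Y).
  apply: (sdisjointC (sdisjoint_mulrn (n := (n * m)%N) p0 YnY)).
    apply: sle_subr; apply: sle_trans YE _.
    apply: sle_trans (sle_mulrn2 m EA) _.
    by rewrite mulrnDl -mulrnA addrC; exact: sle_refl.
  by apply/sle_subr/sle_addr_ge0/mulrn_sge0.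
Qed.

Lemma proper_cone_bigcup (I : Type) (D : set I) (N : I -> set F) :
  D !=set0 -> (forall i, D i -> proper_cone (N i)) ->
  (forall i j, D i -> D j -> N i `<=` N j \/ N j `<=` N i) ->
  proper_cone (\bigcup_(i in D) N i).
Proof.
move=> [i0 Di0] Nc Ntot.
have join X Y : (\bigcup_(i in D) N i) X -> (\bigcup_(i in D) N i) Y ->
    exists i, [/\ D i, N i X & N i Y].
  move=> [i Di NX] [j Dj NY].
  have [ij|ji] := Ntot i j Di Dj; first by exists j; split=> //; exact: ij.
  by exists i; split=> //; exact: ji.
split.
- by exists i0; last exact: cone0 (Nc _ Di0).
- by move=> X Y XY [i Di NY]; exists i; last exact: (cone_down (Nc _ Di) XY NY).
- move=> X Y h /(join _ _ h) [i [Di NX NY]].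
  by exists i; last exact: (coneD (Nc _ Di) NX NY).
- move=> X Y h /(join _ _ h) [i [Di NX NY]].
  by exists i; last exact: (cone_oplus (Nc _ Di) NX NY).
- by move=> [i Di]; exact: cone_proper (Nc _ Di).
Qed.

(** A maximal proper cone above [N0] is total: if it contained neither [X] nor [- X], adjoining [X]
    would give a larger proper cone. *)
Lemma total_cone_exists N0 : proper_cone N0 ->
  exists N, [/\ proper_cone N, N0 `<=` N & forall X, N X \/ N (- X)].
Proof.
move=> N0c.
have [G GG|N [Nc Nmax]] := @Zorn_bigcup F [set N | proper_cone (N0 `|` N)].
  move=> Gtot /=.
  (* The chain may be empty; the added member [set0] contributes [N0] itself and makes the family
     nonempty. *)
  have -> : N0 `|` \bigcup_(X in G) X =
      \bigcup_(X in G `|` [set set0]) (N0 `|` X).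
    apply/seteqP; split=> [X [NX|[Y GY YX]]|X [Y [GY|->] [NX|YX]]] //.
    - by exists set0; [right|left].
    - by exists Y; [left|right].
    - by left.
    - by right; exists Y.
    - by left.
  apply: proper_cone_bigcup; first by exists set0; right.
    by move=> i [/GG //|->]; rewrite setU0.
  move=> i j [Gi|->] [Gj|->].
  - by have [ij|ji] := Gtot _ _ Gi Gj; [left|right]; exact: setUS.
  - by right; apply: setUS.
  - by left; apply: setUS.
  - by left.
exists (N0 `|` N); split=> // X.
have [|NX] := pselect ((N0 `|` N) (- X)); [by right|left].
apply: contrapT => NX'; apply: (Nmax (cone_adjoin (N0 `|` N) X)) => /=.
  split; last first.
    by move=> /(_ X (mem_cone_adjoin X Nc)) ?; apply: NX'; right.
  by move=> Y NY; apply: sub_cone_adjoin => //; right.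
rewrite (_ : N0 `|` _ = cone_adjoin (N0 `|` N) X); last first.
  by apply/setUidPr => Y NY; apply: sub_cone_adjoin => //; left.
exact: cone_adjoin_proper.
Qed.

End Cones.

Lemma ler_rat_gt (R : realType) (a b : R) :
  (forall t : rat, b < ratr t -> a <= ratr t) -> a <= b.
Proof.
move=> h; rewrite leNgt; apply/negP => /rat_in_itvoo [t /itvP tab].
by have := h t; rewrite tab leNgt tab => /(_ isT).
Qed.

(** * Characters from total cones *)

Section Characters.
Variables (R : realType) (F : perfectSemifieldType) (E : F).
Hypothesis Eu : order_unit E.
Implicit Types (X Y : F) (N : set F) (phi : spectrum R E).

Lemma spectrumD phi X Y : phi (X + Y) = phi X + phi Y.
Proof. exact: characterD (spectrum_char phi) _ _. Qed.

Lemma spectrum_oplus phi X Y : phi (X ⊕ Y) = Num.max (phi X) (phi Y).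
Proof. exact: character_oplus (spectrum_char phi) _ _. Qed.

Lemma spectrum0 phi : phi 0 = 0.
Proof. by apply: (@addIr _ (phi 0)); rewrite -spectrumD !add0r. Qed.

Lemma spectrumN phi X : phi (- X) = - phi X.
Proof. by apply: (@addIr _ (phi X)); rewrite -spectrumD !addNr spectrum0. Qed.

Lemma spectrumB phi X Y : phi (X - Y) = phi X - phi Y.
Proof. by rewrite spectrumD spectrumN. Qed.

Lemma spectrumMn phi X n : phi (X *+ n) = phi X *+ n.
Proof. by elim: n => [|n IHn]; rewrite ?spectrum0 // !mulrS spectrumD IHn. Qed.

Lemma spectrumMz phi X n : phi (X *~ n) = phi X *~ n.
Proof.
by case: n => n; rewrite ?NegzE ?mulrNz ?spectrumN -!pmulrn spectrumMn.
Qed.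

Lemma spectrum_qscale phi t : phi (qscale t E) = ratr t.
Proof.
have := congr1 phi (qscaleP t E); rewrite !spectrumMz spectrum_unit => h.
apply: (@mulIf _ (denq t)%:~R); first by rewrite intr_eq0 denq_neq0.
by rewrite mulrzr h /ratr mulfVK // intr_eq0 denq_neq0.
Qed.

Lemma spectrum_le phi X Y : X ⊑ Y -> phi X <= phi Y.
Proof. by rewrite /sle => <-; rewrite spectrum_oplus le_max lexx. Qed.

Lemma is_bound_spectrum phi X t : is_bound E X t -> `|phi X| <= ratr t.
Proof.
move=> [_ [/(spectrum_le phi) h1 /(spectrum_le phi)]].
by move: h1; rewrite spectrumN spectrum_qscale ler_norml => -> ->.
Qed.

Lemma spectrum_le_radius phi X : (`|phi X|%:E <= order_radius R E X)%E.
Proof.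
by apply: le_ereal_inf_tmp => _ [t /is_bound_spectrum h <-]; rewrite lee_fin.
Qed.

(** A character with phi E = 1 is recovered from its set of nonpositive elements: phi X is the
    infimum of the rationals t with phi (X - t E) <= 0. *)
Definition cone_fun N X : R := inf (@ratr R @` [set t | N (X - qscale t E)]).

Section ConeFun.
Variable N : set F.
Hypotheses (Nc : proper_cone E N) (Ntot : forall X, N X \/ N (- X)).
Local Notation f := (cone_fun N).

Lemma cone_qscale t : N (qscale t E) -> t <= 0.
Proof.
move=> Nt; rewrite leNgt; apply/negP => t0; apply: (cone_proper Nc).
have := coneMn `|denq t|%N Nc Nt; rewrite qscale_nat ?ltW //.
apply: (cone_down Nc); apply: sle_mulrn; first exact: order_unit_ge0.
by rewrite absz_gt0 numq_eq0 gt_eqF.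
Qed.

Lemma cone_has_inf X : has_inf (@ratr R @` [set t | N (X - qscale t E)]).
Proof.
have [t [t0 [tX Xt]]] := Eu X; split.
  exists (ratr t), t => //=; apply: (cone_down Nc) (cone0 Nc).
  by apply: sle_subr; rewrite add0r.
exists (ratr (- t)) => _ [s /= Ns <-]; rewrite ler_rat.
have : N (qscale (- t - s) E).
  apply: (cone_down Nc) Ns; rewrite qscaleD !qscaleN.
  by apply: sle_addr.
by move=> /cone_qscale; rewrite subr_le0.
Qed.

Lemma cone_fun_le X t : N (X - qscale t E) -> f X <= ratr t.
Proof. by move=> Nt; apply: ge_inf; [exact: (cone_has_inf X).2|exists t]. Qed.

Lemma cone_fun_lt X t : f X < ratr t -> N (X - qscale t E).
Proof.
move=> /(inf_lt (cone_has_inf X).1) [_ [s /= Ns <-]].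
rewrite ltr_rat => /ltW st.
apply: (cone_down Nc) Ns; rewrite ![X - _]addrC; apply: sle_addr.
by apply: sle_opp; apply: qscale_le => //; exact: order_unit_ge0.
Qed.

Lemma cone_fun_sub X Y : f (X + Y) <= f X + f Y.
Proof.
(* Otherwise there are rationals t > f Y and s > f X with s + t < f (X + Y), against the stability
   of [N] under sums. *)
rewrite leNgt; apply/negP; rewrite -ltrBrDl => /rat_in_itvoo [t /itvP tXY].
have /cone_fun_lt Nt : f Y < ratr t by rewrite tXY.
have : f X < f (X + Y) - ratr t by rewrite ltrBrDr -ltrBrDl tXY.
move=> /rat_in_itvoo [s /itvP sXY].
have /cone_fun_lt Ns : f X < ratr s by rewrite sXY.
have := coneD Nc Ns Nt; rewrite addrACA -opprD -qscaleD => /cone_fun_le.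
by rewrite leNgt rmorphD -ltrBrDr sXY.
Qed.

(** Subadditivity and f 0 >= 0 give one inequality. Totality gives the other: for t > - f X the
    element X + t E is outside [N], so its opposite is inside. *)
Lemma cone_funN X : f (- X) = - f X.
Proof.
apply/eqP; rewrite eq_le; apply/andP; split; last first.
  rewrite lerNl -subr_ge0 opprK addrC.
  apply: le_trans (cone_fun_sub _ _); rewrite addNr.
  rewrite leNgt; apply/negP => /rat_in_itvoo [t /itvP t0].
  have /cone_fun_lt : f 0 < ratr t by rewrite t0.
  rewrite sub0r -qscaleN => /cone_qscale; rewrite oppr_le0 -(ler0q R).
  by rewrite leNgt t0.
apply: ler_rat_gt => t; rewrite ltrNl -rmorphN => tX; apply: cone_fun_le.
have [Nt|] := Ntot (X - qscale (- t) E); last by rewrite opprB addrC qscaleN.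
by have := le_lt_trans (cone_fun_le Nt) tX; rewrite ltxx.
Qed.

Lemma cone_funD X Y : f (X + Y) = f X + f Y.
Proof.
apply/eqP; rewrite eq_le cone_fun_sub /=.
have := cone_fun_sub (- X) (- Y); rewrite -opprD !cone_funN; lra.
Qed.

Lemma cone_fun_oplus X Y : f (X ⊕ Y) = Num.max (f X) (f Y).
Proof.
have mono Z Z' : Z ⊑ Z' -> f Z <= f Z'.
  move=> ZZ'; apply: ler_rat_gt => t /cone_fun_lt Nt; apply: cone_fun_le.
  by apply: (cone_down Nc) Nt; exact: sle_addr.
apply/eqP; rewrite eq_le; apply/andP; split; last first.
  rewrite ge_max; apply/andP; split; apply: mono; [exact: sle_oplusl|].
  exact: sle_oplusr.
apply: ler_rat_gt => t; rewrite gt_max.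
move=> /andP[/cone_fun_lt NX /cone_fun_lt NY].
by apply: cone_fun_le; rewrite addr_oplusl; exact: (cone_oplus Nc).
Qed.

Lemma cone_fun_unit : f E = 1.
Proof.
apply/eqP; rewrite eq_le; apply/andP; split.
  rewrite -(rmorph1 (@ratr R)); apply: cone_fun_le; rewrite qscale1 subrr.
  exact: (cone0 Nc).
apply: ler_rat_gt => t /cone_fun_lt.
rewrite -[X in X - _]qscale1 -qscaleN -qscaleD.
by move=> /cone_qscale; rewrite subr_le0 -(ler_rat R) rmorph1.
Qed.

Lemma cone_fun_character : character f.
Proof.
split; [|exact: cone_fun_oplus|exact: cone_funD].
by exists E; rewrite cone_fun_unit oner_neq0.
Qed.

End ConeFun.

(** For each [t] in [D], the element t E - X can be adjoined to the cone of nonpositive elements.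
    The resulting cones increase with [t], so their union is proper, and a total cone above it gives
    one [phi] for all [t] at once. *)
Lemma spectrum_ge_bound X (D : set rat) : D !=set0 -> ~ E ⊑ 0 ->
  (forall t, D t -> ~ X ⊑ qscale t E) ->
  exists phi, forall t, D t -> ratr t <= phi X.
Proof.
move=> D0 E0 hX.
have N0c := nonpos_proper_cone E0.
pose g t := cone_adjoin [set X | X ⊑ 0] (qscale t E - X).
have gle s t : s <= t -> g s `<=` g t.
  move=> st; apply: cone_adjoin_le; apply: sle_addr; apply: qscale_le => //.
  exact: order_unit_ge0.
have /(total_cone_exists Eu) [N [Nc N0 Ntot]] :
    proper_cone E (\bigcup_(t in D) g t).
  apply: proper_cone_bigcup => // [t Dt|s t _ _].
    apply: cone_adjoin_proper => //=; rewrite opprB => /sle_subl.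
    by rewrite add0r; exact: hX.
  by have [/gle|/ltW/gle] := leP s t; [left|right].
exists (Spectrum (cone_fun_character Nc Ntot) (cone_fun_unit Nc)) => t Dt /=.
have /N0 : (\bigcup_(t in D) g t) (qscale t E - X).
  by exists t => //; exact: mem_cone_adjoin N0c.
rewrite addrC -[qscale t E]opprK -qscaleN => /(cone_fun_le Nc).
by rewrite (cone_funN Nc Ntot) rmorphN lerN2.
Qed.

Lemma order_radius_attained X : ~ E ⊑ 0 ->
  exists phi, order_radius R E X = `|phi X|%:E.
Proof.
move=> E0; set r := order_radius R E X.
have r0 : (0 <= r)%E by exact: order_radius_ge0.
have rfin : r \is a fin_num by exact: order_radius_fin_num.
pose D := [set t : rat | ((ratr t : R)%:E < r)%E].
(* This keeps [D] nonempty even when [r] is 0. *)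
have DN1 : D (-1) by apply: lt_le_trans r0; rewrite lte_fin ltrq0.
have Ege0 := order_unit_ge0 Eu.
(* Otherwise both [X] and [- X] are below m E for some [m] in [D]. If m >= 0 this contradicts the
   definition of [r]; if m < 0, adding the two gives [E ⊑ 0]. *)
have [Y YX hY] : exists2 Y, Y = X \/ Y = - X &
    forall t, D t -> ~ Y ⊑ qscale t E.
  have [h|] := pselect (forall t, D t -> ~ X ⊑ qscale t E).
    by exists X => //; left.
  move=> /existsNP [t /not_implyP [Dt /contrapT Xt]].
  exists (- X); first by right.
  move=> s Ds Xs; pose m := Num.max s t.
  have Dm : D m by rewrite /m; case: leP.
  have Xm : X ⊑ qscale m E.
    by apply: sle_trans Xt _; apply: qscale_le => //; rewrite le_max lexx orbT.
  have NXm : - X ⊑ qscale m E.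
    by apply: sle_trans Xs _; apply: qscale_le => //; rewrite le_max lexx.
  have [m0|m0] := leP 0 m.
    suff : (r <= (ratr m : R)%:E)%E by rewrite leNgt Dm.
    apply: ereal_inf_lbound; exists m => //; split=> //; split=> //.
    exact: sle_oppl.
  have := sle_add Xm NXm; rewrite subrr -qscaleD => mm; apply: E0.
  rewrite -[E]opprK; have /sle_opp : 0 ⊑ - E; last by rewrite oppr0.
  apply: (@qscale_ge0_inv _ (- (m + m))); first by lra.
  by rewrite qscaleN qscale_opp opprK.
have [|phi hphi] := spectrum_ge_bound _ E0 hY; first by exists (-1).
have phiY : `|phi X| = `|phi Y|.
  by case: YX => ->; rewrite ?spectrumN ?normrN.
exists phi; apply/eqP; rewrite eq_le spectrum_le_radius andbT phiY.
rewrite -(fineK rfin) lee_fin; apply: le_trans (ler_norm _).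
rewrite -[_ <= _]lerN2; apply: ler_rat_gt => t.
rewrite ltrNl -rmorphN lerNl -rmorphN => tr; apply: hphi.
by rewrite /D /= -(fineK rfin) lte_fin.
Qed.

End Characters.

(** * The spectrum *)

(** The image filter clusters at some [v]. If the preimage of a neighbourhood of [v] were not in
    [G], its complement would be, against clustering. *)
Lemma ultra_cvg_compact (T : Type) (V : topologicalType) (f : T -> V)
    (G : set_system T) (A : set V) :
  UltraFilter G -> compact A -> G (f @^-1` A) ->
  exists v : V, f x @[x --> G] --> v.
Proof.
move=> GU cA GA; have PG : ProperFilter G by exact: ultra_proper.
have [v [_ clv]] := cA (f x @[x --> G]) _ GA.
exists v => B vB; have [//|GB] := in_ultra_setVsetC (f @^-1` B) GU.
by have [w [/= nBw Bw]] := clv (~` B) B GB vB.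
Qed.

Section SpectrumCompact.
Variables (R : realType) (F : perfectSemifieldType) (E : F).
Hypothesis Eu : order_unit E.
Local Notation K := (spectrum R E).

Lemma cvg_spectrum (G : set_system K) (phi : K) : Filter G ->
  (forall X, (fun psi : K => psi X) @ G --> phi X) -> G --> phi.
Proof.
move=> FG h; apply/cvg_sup => X A [_ [[B oB <-] phiB] BA].
by apply: filterS BA _; apply: h; exact: open_nbhs_nbhs.
Qed.

(** Along an ultrafilter each evaluation stays in a segment, hence converges. Both laws and the
    value 1 at [E] pass to the pointwise limit, which is therefore in the spectrum. *)
Lemma spectrum_compact : compact [set: K].
Proof.
rewrite compact_ultra => G GU _.
have PG : ProperFilter G by exact: ultra_proper.
have /choice [phi phiP] X : exists a : R, (fun psi : K => psi X) @ G --> a.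
  have [t tX] := Eu X.
  apply: (@ultra_cvg_compact K R (fun psi : K => psi X) G
    `[- ratr t, ratr t]%classic) => //.
    exact: segment_compact.
  apply: filterE => psi /=; rewrite in_itv /= -ler_norml.
  exact: is_bound_spectrum.
have lim_unique X (a : R) : (fun psi : K => psi X) @ G --> a -> phi X = a.
  exact: cvg_unique (phiP X).
have phiD X Y : phi (X + Y) = phi X + phi Y.
  apply: lim_unique.
  rewrite (_ : (fun psi : K => psi (X + Y)) = fun psi : K => psi X + psi Y).
    exact: cvgD.
  by apply/funext => psi; exact: spectrumD.
have phi_oplus X Y : phi (X ⊕ Y) = Num.max (phi X) (phi Y).
  apply: lim_unique.
  rewrite (_ : (fun psi : K => psi (X ⊕ Y)) =
    fun psi : K => Num.max (psi X) (psi Y)).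
    apply: (@continuous2_cvg _ _ _ _ G _ _ _
      (fun x y : R => Num.max x y)) => //.
    exact: (@max_continuous _ R (_, _)).
  by apply/funext => psi; exact: spectrum_oplus.
have phiE : phi E = 1.
  apply: lim_unique.
  rewrite (_ : (fun psi : K => psi E) = cst 1).
    exact: cvg_cst.
  by apply/funext => psi; exact: spectrum_unit.
have phic : character phi.
  by split=> //; exists E; rewrite phiE oner_neq0.
by exists (Spectrum phic phiE); split=> //; exact: cvg_spectrum.
Qed.

End SpectrumCompact.

(** * Density of the evaluations: lattice Stone-Weierstrass *)

Lemma near_lt_continuous (R : realType) (T : topologicalType) (f g : T -> R)
    (x : T) : continuous f -> continuous g -> f x < g x ->
  \forall y \near x, f y < g y.
Proof.
move=> fc gc fgx.
have : (fun y => g y - f y) @ x --> g x - f x.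
  by apply: cvgB; [exact: gc|exact: fc].
move=> /cvgr_gt /(_ 0); rewrite subr_gt0 => /(_ fgx).
by apply: filterS => y; rewrite subr_gt0.
Qed.

Lemma continuous_subr_cst (R : realType) (T : topologicalType) (f : T -> R)
    (a : R) : continuous f -> continuous (fun x => f x - a).
Proof. by move=> fc x; apply: cvgB; [exact: fc|exact: cvg_cst]. Qed.

Section Density.
Variables (R : realType) (F : perfectSemifieldType) (E : F).
Hypothesis Eu : order_unit E.
Local Notation K := (spectrum R E).
Implicit Types (X Y Z : F) (phi psi : K).

Lemma spectrum_ext phi psi : (forall X, phi X = psi X) -> phi = psi.
Proof.
case: phi psi => [f fc f1] [g gc g1] /= /funext fg; case: g / fg gc g1 => gc g1.
by congr Spectrum; exact: Prop_irrelevance.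
Qed.

(** Compactness makes pointwise domination uniform. That [L] is nonempty settles the case of an
    empty spectrum. *)
Lemma oplus_closed_above (L : set F) (f : K -> R) : continuous f -> L !=set0 ->
  (forall X Y, L X -> L Y -> L (X ⊕ Y)) ->
  (forall psi, exists2 X, L X & f psi < psi X) ->
  exists2 X, L X & forall psi, f psi < psi X.
Proof.
move=> fc L0 Loplus Lf.
(* [L] is directed upwards, which replaces the choice of finite subcovers. *)
pose G := filter_from L (fun X => [set Y | L Y /\ X ⊑ Y]).
have FG : Filter G.
  apply: filter_from_filter => // X Y LX LY.
  exists (X ⊕ Y); first exact: Loplus.
  move=> Z /= [LZ XYZ]; split; split=> //; apply: sle_trans XYZ.
    exact: sle_oplusl.
  exact: sle_oplusr.
have [|X LX /(_ X) /= h] := (@compact_near_coveringP K setT).1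
    (spectrum_compact Eu) F G (fun Y psi => f psi < psi Y) FG.
  move=> psi _; have [X LX fX] := Lf psi.
  exists ([set psi' : K | f psi' < psi' X], [set Y | L Y /\ X ⊑ Y]) => /=.
    split; last by exists X.
    exact: (near_lt_continuous fc (@Defs.eval_continuous R F E X) fX).
  move=> [psi' Y] /= [fX' [_ XY]]; apply: lt_le_trans fX' _.
  exact: spectrum_le.
exists X => // psi; apply: h => //; split=> //; exact: sle_refl.
Qed.

(** If the characters agree, take a rational multiple of [E] between [b] and [a]. Otherwise phi Z <
    q < psi Z for some [Z] and rational [q], and a large multiple of Z - q E is below [a] at [phi]
    and above [b] at [psi]. *)
Lemma spectrum_interpolation phi psi (a b : R) : (phi = psi -> b < a) ->
  exists X, phi X < a /\ b < psi X.
Proof.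
have [/spectrum_ext -> /(_ erefl)|] := pselect (forall X, phi X = psi X).
  move=> /rat_in_itvoo [t /itvP tab]; exists (qscale t E).
  by rewrite spectrum_qscale !tab.
move=> /existsNP [Z0 Z0P] _.
have [Z] : exists Z, phi Z < psi Z.
  have [|] := ltP (phi Z0) (psi Z0); first by exists Z0.
  rewrite le_eqVlt => /orP[/eqP /esym //|h]; exists (- Z0).
  by rewrite !spectrumN ltrN2.
move=> /rat_in_itvoo [q /itvP qZ].
have qphi : 0 < ratr q - phi Z by rewrite subr_gt0 qZ.
have qpsi : 0 < psi Z - ratr q by rewrite subr_gt0 qZ.
(* An integer n > x + y makes n (q - phi Z) exceed |a| and n (psi Z - q) exceed |b|. *)
pose x := `|a| / (ratr q - phi Z); pose y := `|b| / (psi Z - ratr q).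
have x0 : 0 <= x by rewrite divr_ge0 // ltW.
have y0 : 0 <= y by rewrite divr_ge0 // ltW.
have := archi_boundP (addr_ge0 x0 y0); set n := Num.bound _ => xyn.
exists ((Z - qscale q E) *+ n); rewrite !spectrumMn !spectrumB !spectrum_qscale.
rewrite -[(phi Z - _) *+ n]mulr_natl -[(psi Z - _) *+ n]mulr_natl; split.
  have : x < n%:R by apply: le_lt_trans xyn; rewrite lerDl.
  rewrite ltr_pdivrMr //; have := ler_norm (- a); rewrite normrN; lra.
have : y < n%:R by apply: le_lt_trans xyn; rewrite lerDr.
by rewrite ltr_pdivrMr //; have := ler_norm b; lra.
Qed.

Lemma Theta_dense (f : K -> R) (e : R) : continuous f -> 0 < e ->
  exists X, forall psi, `|psi X - f psi| < e.
Proof.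
move=> fc e0.
(* First pass: interpolate at pairs with [phi] fixed; the upper bound at [phi] survives [⊕]. *)
have above phi : exists2 X, phi X < f phi + e & forall psi, f psi - e < psi X.
  apply: (@oplus_closed_above [set X | phi X < f phi + e]
    (fun psi => f psi - e)).
  - exact: continuous_subr_cst.
  - have [|X []] := @spectrum_interpolation phi phi (f phi + e) (f phi - e).
      by move=> _; lra.
    by exists X.
  - by move=> X Y /= hX hY; rewrite spectrum_oplus gt_max hX.
  - move=> psi; have [|X []] :=
      @spectrum_interpolation phi psi (f phi + e) (f psi - e).
      by move=> ->; lra.
    by exists X.
(* Second pass, on opposites, where [⊕] plays the part of the minimum: the one-sided bound valid
   everywhere is kept, and the other one, known at each [phi], becomes uniform. *)
have [||||X XL Xf] := @oplus_closed_above
  [set X | forall psi, psi X < e - f psi] (fun psi => - f psi - e).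
- by apply: continuous_subr_cst => psi; exact: continuousN (fc psi).
- have [[phi _]|K0] := pselect (exists phi : K, True).
    have [X _ hX] := above phi; exists (- X) => psi.
    by have := hX psi; rewrite spectrumN; lra.
  by exists 0 => psi; exfalso; apply: K0; exists psi.
- by move=> X Y hX hY psi; rewrite spectrum_oplus gt_max hX hY.
- move=> phi; have [X hX Xf] := above phi; exists (- X).
    by move=> psi; have := Xf psi; rewrite spectrumN; lra.
  by rewrite spectrumN; lra.
exists (- X) => psi; rewrite spectrumN ltr_norml.
by have := XL psi; have := Xf psi; lra.
Qed.

Lemma order_radius_le_sup X (a : R) : 0 <= a ->
  (forall psi, `|psi X| <= a) -> (order_radius R E X <= a%:E)%E.
Proof.
move=> a0 Xa; have [E0|E0] := pselect (E ⊑ 0).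
  by rewrite (order_unit_le0 Eu E0 X) order_radius_0 lee_fin.
by have [phi ->] := order_radius_attained R Eu X E0; rewrite lee_fin.
Qed.

End Density.

(** * Bijectivity of the evaluation map *)

Section ThetaBijective.
Variables (R : realType) (F : perfectSemifieldType) (E : F).
Hypothesis EB : banach_semifield R E.
Local Notation K := (spectrum R E).
Let Eu : order_unit E := banach_order_unit EB.

Lemma Theta_inj : injective (Theta R E).
Proof.
move=> X Y /continuousEP XY; apply/eqP; rewrite -subr_eq0; apply/eqP.
apply/(banach_order_radius_eq0 EB)/eqP; rewrite eq_le order_radius_ge0 andbT.
apply: order_radius_le_sup => // psi; have e : psi X = psi Y := XY psi.
by rewrite spectrumB e subrr normr0.
Qed.

(** The approximants of [f] form a Cauchy filter, because the radius is controlled by the values of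
    characters. These values are bounded by the radius, so the limit takes the values of [f]. *)
Lemma Theta_surj (f : continuousType K R) : exists X, Theta R E X = f.
Proof.
have fc : continuous f by exact: cts_fun.
pose near e := [set X : radius_space R E |
  forall psi : K, `|psi X - f psi| < e].
pose G := filter_from [set e : R | 0 < e] near.
have PG : ProperFilter G.
  apply: filter_from_proper; last by move=> e e0; exact: Theta_dense.
  apply: filter_from_filter; first by exists 1 => /=.
  move=> d e d0 e0; exists (Num.min d e); first by rewrite /= lt_min d0.
  by move=> X hX; split=> psi; have := hX psi; rewrite lt_min => /andP[].
have [|X GX] := banach_complete EB PG.
  apply: cauchy_exP => e e0; have e4 : 0 < e / 4 by rewrite divr_gt0.
  have [X hX] := Theta_dense Eu fc e4.
  exists X; exists (e / 4) => // Y hY.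
  (* Two e/4-approximants differ by less than e/2 at every character, so by at most e/2 in radius;
     the strict ball of radius [e] leaves room for this. *)
  apply: (@le_lt_trans _ _ (e / 2)%:E); last by rewrite lte_fin; lra.
  apply: order_radius_le_sup => //; first by lra.
  move=> psi; rewrite spectrumB; have := hX psi; have := hY psi.
  by rewrite !ltr_norml ler_norml; lra.
exists X; apply/continuousEP => psi; suff : psi X = f psi by [].
apply/eqP; rewrite -subr_eq0 -normr_le0.
apply/ler_addgt0Pr => e e0; rewrite add0r.
have e2 : 0 < e / 2 by rewrite divr_gt0.
have [Y [XY Yf]] : ball X (e / 2) `&` near (e / 2) !=set0.
  by apply: (@filter_ex _ G); apply: filterI;
    [apply: GX; exact: nbhsx_ballx|exists (e / 2)].
have : (`|psi (X - Y)|%:E < (e / 2)%:E)%E.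
  exact: le_lt_trans (spectrum_le_radius _ _) XY.
rewrite lte_fin spectrumB; have := Yf psi.
by rewrite !ltr_norml ler_norml; lra.
Qed.

End ThetaBijective.

(** * Quotients *)

Lemma banach_quotient (R : realType) (F : perfectSemifieldType) (E : F)
    (c : congruence F) : banach_semifield R E -> closed_congruence R E c ->
  banach_semifield R (\pi_(cong_quot c) E).
Proof.
move=> EB c_closed; have Eu := banach_order_unit EB.
have piD := @pi_addr _ _ _ _ _ (cong_quot c).
have pi_surj (V : cong_quot c) : exists X, \pi_(cong_quot c) X = V.
  by exists (repr V); rewrite reprK.
split.
- exact: order_unit_morph (@pi_oplus _ c) piD pi_surj Eu.
- move=> V; split=> [V0|->]; last exact: order_radius_0.
  have [X XV] := pi_surj V.
  suff /cong_quotP : c 0 X by rewrite XV => <-; exact: pi_zeror.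
  (* [V] has lifts arbitrarily close to 0, all congruent to [X]; so (0, X) is in the closure of the
     congruence. *)
  apply: (c_closed (0, X)) => B [[B1 B2] /= [nB1 nB2] B12].
  have [e /= e0 eB] := (nbhs_ballP _ _).1 nB1.
  have [|Y YV Ye] := order_radius_lift (R := R) (e := e)
    (@pi_oplus _ c) piD pi_surj Eu (V := V).
    by rewrite V0 lte_fin.
  exists (Y, X); split; first by apply/cong_quotP; rewrite YV XV.
  apply: B12; split; last exact: nbhs_singleton nB2.
  apply: eB; apply: ball_sym.
  suff : (order_radius R E (Y - 0)%R < e%:E)%E by [].
  by rewrite subr0.
- apply: (complete_morph (@pi_oplus _ c) piD pi_surj Eu).
  exact: banach_complete EB.
Qed.

Theorem theorem8 (R : realType) (F : perfectSemifieldType) (E : F)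
    (F_neq0 : exists X : F, X != 0) (F_banach : banach_semifield R E)
    (c : congruence F) (c_closed : closed_congruence R E c) :
  let pi : F -> cong_quot c := \pi_(cong_quot c) in
  let E1 : cong_quot c := pi E in
  let K1 := spectrum R E1 in
  let j : K1 -> spectrum R E := @spectrum_pullback R F E c in
  let Theta1 : cong_quot c -> continuousType K1 R := Theta R E1 in
  [/\ forall X Y : F,
        c X Y <-> {in range j, Theta R E X =1 Theta R E Y},
      [/\ banach_semifield R E1,
          banach_semifield R (cts_one R K1),
          bijective Theta1,
          {morph Theta1 : X1 Y1 / X1 ⊕ Y1} /\
          {morph Theta1 : X1 Y1 / X1 + Y1}
        & forall X1 : cong_quot c, exists m : R,
            [/\ is_max0 (fun phi : K1 => `|Theta1 X1 phi|) m,
                ereal_inf (order_radius R E @` [set X | pi X = X1])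
                  = m%:E
              & order_radius R E1 X1 = m%:E]]
    & forall (X : F) (phi : K1), Theta1 (pi X) phi = Theta R E X (j phi)].
Proof.
move=> pi E1 K1 j Theta1.
have E1B : banach_semifield R E1 by exact: banach_quotient.
have Eu := banach_order_unit F_banach; have E1u := banach_order_unit E1B.
have Theta1_inj : injective Theta1 by exact: Theta_inj.
have Theta1_surj f : exists X1, Theta1 X1 = f by exact: Theta_surj.
have Theta1_bij : bijective Theta1.
  have /choice [g gK] := Theta1_surj.
  by exists g => // X1; apply: Theta1_inj; rewrite gK.
have Theta1_oplus : {morph Theta1 : X1 Y1 / X1 ⊕ Y1}.
  by move=> X1 Y1; apply/continuousEP => phi; exact: spectrum_oplus.
have Theta1D : {morph Theta1 : X1 Y1 / X1 + Y1}.
  by move=> X1 Y1; apply/continuousEP => phi; exact: spectrumD.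
have Theta1E : Theta1 E1 = cts_one R K1.
  by apply/continuousEP => phi; exact: spectrum_unit.
have pi_surj (X1 : cong_quot c) : exists X, pi X = X1.
  by exists (repr X1); rewrite /pi reprK.
split=> //.
- move=> X Y; rewrite cong_quotP; split=> [XY psi|XY].
    rewrite inE => -[phi _ <-].
    by have : phi (pi X) = phi (pi Y) by rewrite /pi XY.
  apply: Theta1_inj; apply/continuousEP => phi.
  by apply: (XY (j phi)); rewrite inE; exists phi.
- split=> //.
    (* [Theta1] is a bijective morphism sending [E1] to 1, so the Banach property of the continuous
       functions is transported from the quotient. *)
    rewrite -Theta1E; split.
    + exact: order_unit_morph Theta1_oplus Theta1D Theta1_surj E1u.
    + move=> f; have [X1 <-] := Theta1_surj f.
      rewrite -(order_radius_fibre R Theta1_oplus Theta1D Theta1_surj E1u).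
      rewrite (_ : [set X | _] = [set X1]); last first.
        by apply/seteqP; split=> [X /= /Theta1_inj|X /= ->].
      rewrite image_set1 ereal_inf1 (banach_order_radius_eq0 E1B).
      split=> [->|]; first exact: morph_sf0 Theta1D.
      by rewrite -(morph_sf0 Theta1D) => /Theta1_inj.
    + apply: (complete_morph Theta1_oplus Theta1D Theta1_surj E1u).
      exact: banach_complete E1B.
  move=> X1; have rfin := order_radius_fin_num R X1 E1u.
  exists (fine (order_radius R E1 X1)); rewrite fineK //; split=> //; last first.
    exact: (order_radius_fibre R (@pi_oplus _ c) (@pi_addr _ _ _ _ _ _)
      pi_surj Eu).
  (* In the degenerate case [K1] is empty and the maximum is 0 by convention. *)
  have [E0|E0] := pselect (E1 ⊑ 0).
    right; split; last by rewrite (order_unit_le0 E1u E0 X1) order_radius_0.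
    apply/seteqP; split=> // x [phi _ _].
    by have := spectrum_le phi E0; rewrite spectrum_unit spectrum0 ler10.
  left; have [phi rE] := order_radius_attained R E1u X1 E0; rewrite rE.
  split; first by exists phi.
  by move=> _ [psi _ <-]; have := spectrum_le_radius psi X1; rewrite rE lee_fin.
Qed.
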